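(* There exists an uncountable collection of pairwise non-isometric (i.e. not isometrically isomorphic) Banach spaces $X$ such that each $X$ is a predual of $\ell_1$ (that is, $X^*$ is isometrically isomorphic to $\ell_1$), each $X$ is Hahn-Banach smooth, and no $X$ in the collection is $M$-embedded.
   Context: Scalars are real. A Banach space $X$ is Hahn-Banach smooth if every $x^*\in X^*$ has a unique norm-preserving linear extension from $X$ (canonically embedded in $X^{**}$) to $X^{**}$. A closed subspace $Y$ of a Banach space $Z$ is an $M$-ideal in $Z$ if $Z^*=Y^\perp\oplus_{\ell_1}W$ for some subspace $W$ of $Z^*$ (direct sum with $\|u+v\|=\|u\|+\|v\|$ for $u\in Y^\perp$, $v\in W$), where $Y^\perp$ is the annihilator of $Y$. $X$ is $M$-embedded if its canonical image is an $M$-ideal in $X^{**}$. *)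

(* Defs.v *)
From HB Require Import structures.
From mathcomp Require Import all_boot all_order all_algebra.
From mathcomp Require Import all_classical all_reals all_analysis.

Set Implicit Arguments.
Unset Strict Implicit.
Unset Printing Implicit Defensive.

Import Order.TTheory GRing.Theory Num.Theory.
Import numFieldNormedType.Exports.

Local Open Scope classical_set_scope.
Local Open Scope ring_scope.

Section DualSpace.
Context {R : realType} {X : normedModType R}.
Implicit Types (f : X -> R^o).

Definition continuous_functional : {pred (X -> R^o)} :=
  fun f => `[< linear f /\ continuous f >].

Lemma continuous_functionalP f :
  reflect (linear f /\ continuous f) (f \in continuous_functional).
Proof. exact: asboolP. Qed.

Lemma continuous_functional_submod_closed :
  GRing.submod_closed continuous_functional.
Proof.
split.
  apply/continuous_functionalP; split; last exact: cst_continuous.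
  by move=> a x y; rewrite /= scaler0 addr0.
move=> a f g /continuous_functionalP[lf cf] /continuous_functionalP[lg cg].
apply/continuous_functionalP; split.
  move=> b x y; rewrite /= !fctE lf lg !scalerDr !scalerA mulrC -!addrA.
  by congr (_ + _); rewrite addrCA.
by move=> x; apply: cvgD; [apply: cvgZl_tmp; exact: cf|exact: cg].
Qed.

HB.instance Definition _ := GRing.isSubmodClosed.Build R (X -> R^o)
  continuous_functional continuous_functional_submod_closed.

End DualSpace.

(* The codomain is [R^o] because that is where [R] carries its structure of
   module over itself. The norm of [dual X] is [dual_norm] below. *)
Record dual {R : realType} (X : normedModType R) := Dual {
  dual_fun :> X -> R^o ;
  _ : dual_fun \in continuous_functional }.

Section DualNorm.
Context {R : realType} {X : normedModType R}.
Implicit Types (f g : dual X) (x : X).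

HB.instance Definition _ := [isSub for @dual_fun R X].
HB.instance Definition _ := [Choice of dual X by <:].
HB.instance Definition _ := [SubChoice_isSubLmodule of dual X by <:].

Lemma dual_linear f : linear f.
Proof. by have /continuous_functionalP[] := valP f. Qed.

HB.instance Definition _ f := GRing.isLinear.Build R X R^o _ f (dual_linear f).

Lemma dual_continuous f : continuous f.
Proof. by have /continuous_functionalP[] := valP f. Qed.

Lemma dualP f g : f =1 g -> f = g.
Proof. by move=> fg; apply/val_inj/funext. Qed.

Definition dual_norm f : R := sup [set `|f x| | x in [set x | `|x| <= 1]].

Lemma dual_has_sup f : has_sup [set `|f x| | x in [set x | `|x| <= 1]].
Proof.
split; first by exists `|f 0|; exists 0 => //=; rewrite normr0.
have /linear_bounded_continuous/bounded_funP/(_ 1)[M fM] := @dual_continuous f.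
by exists M => _ [x /= x1 <-]; exact: fM.
Qed.

Lemma dual_norm_ge0 f : 0 <= dual_norm f.
Proof.
apply: le_trans (_ : `|f 0| <= _) => //.
by apply: sup_upper_bound; [exact: dual_has_sup|exists 0 => //=; rewrite normr0].
Qed.

Lemma le_dual_norm f x : `|f x| <= dual_norm f * `|x|.
Proof.
have [->|x0] := eqVneq x 0; first by rewrite linear0 !normr0 mulr0.
rewrite -ler_pdivrMr ?normr_gt0//.
rewrite -[X in _ / X]normr_id -normfV -normrM mulrC -[_ * f x]linearZ.
apply: sup_upper_bound; first exact: dual_has_sup.
by exists (`|x|^-1 *: x) => //=; rewrite normrZ normfV normr_id mulVf ?normr_eq0.
Qed.

Lemma dual_norm_le f (M : R) : 0 <= M ->
  (forall x, `|f x| <= M * `|x|) -> dual_norm f <= M.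
Proof.
move=> M0 fM; apply: ge_sup; first by have [] := dual_has_sup f.
by move=> _ [x /= x1 <-]; rewrite (le_trans (fM x))// ler_piMr.
Qed.

Lemma dual_normD f g : dual_norm (f + g) <= dual_norm f + dual_norm g.
Proof.
apply: dual_norm_le; first by rewrite addr_ge0// dual_norm_ge0.
move=> x; rewrite (le_trans (ler_normD _ _))// mulrDl.
by rewrite lerD// le_dual_norm.
Qed.

Lemma dual_normZ_le (a : R) f : dual_norm (a *: f) <= `|a| * dual_norm f.
Proof.
apply: dual_norm_le; first by rewrite mulr_ge0// dual_norm_ge0.
by move=> x; rewrite [leLHS]normrM -mulrA ler_wpM2l// le_dual_norm.
Qed.

Lemma dual_normZ (a : R) f : dual_norm (a *: f) = `|a| * dual_norm f.
Proof.
apply/eqP; rewrite eq_le dual_normZ_le/=.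
have [->|a0] := eqVneq a 0; first by rewrite normr0 mul0r dual_norm_ge0.
rewrite -[in leLHS](scalerK a0 f) -ler_pdivlMl ?normr_gt0// -normfV.
exact: dual_normZ_le.
Qed.

Lemma dual_norm0_eq0 f : dual_norm f = 0 -> f = 0.
Proof.
move=> f0; apply: dualP => x; apply/eqP; rewrite -normr_le0.
by rewrite (le_trans (le_dual_norm f x))// f0 mul0r.
Qed.

HB.instance Definition _ := @Lmodule_isNormed.Build R (dual X)
  dual_norm dual_normD dual_normZ dual_norm0_eq0.

Lemma dual_normE f : `|f| = sup [set `|f x| | x in [set x | `|x| <= 1]].
Proof. by []. Qed.

Lemma ler_dual_app f x : `|f x| <= `|f| * `|x|.
Proof. exact: le_dual_norm. Qed.

Lemma ler_dual_norm f (M : R) : 0 <= M ->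
  (forall x, `|f x| <= M * `|x|) -> `|f| <= M.
Proof. exact: dual_norm_le. Qed.

End DualNorm.

Section DualComplete.
Context {R : realType} {X : normedModType R}.

Lemma dual_complete (F : set_system (dual X)) :
  ProperFilter F -> cauchy F -> cvg F.
Proof.
move=> FF /cauchyP Fc.
have Fe (e : R) : 0 < e -> exists g : dual X, \forall f \near F, `|g - f| < e.
  move=> e0; have [g Fg] := Fc e e0; exists g; near=> f.
  by have : ball g e f by near: f; exact: Fg.
have pcvg x : cvg ((fun f : dual X => f x) @ F).
  apply: cauchy_cvg; apply: cauchy_exP => e e0.
  have x10 : 0 < `|x| + 1 by rewrite ltr_wpDl.
  have [g Fg] := Fe (e / (`|x| + 1)) (divr_gt0 e0 x10).
  exists (g x); apply: (filterS _ Fg) => f gf.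
  rewrite /ball/= (le_lt_trans (ler_dual_app (g - f) x))//.
  rewrite ltr_pdivlMr// in gf; rewrite (le_lt_trans _ gf)// ler_wpM2l//.
  by rewrite lerDl ler01.
pose l x : R^o := lim ((fun f : dual X => f x) @ F).
have lcvg x : (fun f : dual X => f x) @ F --> l x by exact: pcvg.
have ll : linear l.
  move=> a x y; apply: (@cvg_unique _ (@norm_hausdorff R R^o) _ _ _ _ (lcvg _)).
  have -> : (fun f : dual X => f (a *: x + y)) =
            (fun f : dual X => a *: f x + f y).
    by apply/funext => f; rewrite dual_linear.
  by apply: cvgD; [apply: cvgZl_tmp; exact: lcvg|exact: lcvg].
have lb (g : dual X) e : (\forall f \near F, `|g - f| < e) ->
    forall x, `|g x - l x| <= e * `|x|.
  move=> gF x.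
  have gl : (fun f : dual X => `|g x - f x|) @ F --> `|g x - l x|.
    by apply: cvg_norm; apply: cvgB; [exact: cvg_cst|exact: lcvg].
  apply: (cvgr_to_le gl).
  near=> f; rewrite /= (le_trans (ler_dual_app (g - f) x))// ler_wpM2r//.
  by apply: ltW; near: f.
pose L : {linear X -> R^o} := HB.pack l (GRing.isLinear.Build R X R^o _ l ll).
have lc : continuous l.
  rewrite -[l]/(L : X -> R^o); apply/linear_bounded_continuous/linear_boundedP.
  have [g /lb gl] := Fe 1 ltr01.
  exists (`|g| + 1); split; first exact: num_real.
  move=> r /ltW gr x; have -> : L x = g x - (g x - l x) by rewrite subKr.
  rewrite (le_trans (ler_normB _ _))//.
  rewrite (le_trans (lerD (ler_dual_app g x) (gl x)))// -mulrDl.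
  by rewrite ler_wpM2r.
have lP : (l : X -> R^o) \in continuous_functional.
  exact/continuous_functionalP.
apply/cvg_ex; exists (Dual lP); apply/cvgrPdist_le => e e0.
have e20 : 0 < e / 2 by rewrite divr_gt0.
have [g gF] := Fe (e / 2) e20; near=> f.
rewrite -(subrK g (Dual lP)) -addrA (le_trans (ler_normD _ _))// (splitr e).
rewrite lerD//; last by apply: ltW; near: f.
apply: ler_dual_norm => [|x]; first exact: ltW.
rewrite (_ : (Dual lP - g) x = l x - g x)// distrC.
exact: lb.
Unshelve. all: by end_near. Qed.

HB.instance Definition _ := Uniform_isComplete.Build (dual X) dual_complete.

End DualComplete.

Section CanonicalEmbedding.
Context {R : realType} {X : normedModType R}.

Definition evaluation (x : X) : dual X -> R^o := fun f => f x.

Lemma evaluation_continuous_functional x :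
  evaluation x \in continuous_functional.
Proof.
have el : linear (evaluation x) by [].
pose E : {linear dual X -> R^o} :=
  HB.pack (evaluation x) (GRing.isLinear.Build R _ R^o _ _ el).
apply/continuous_functionalP; split => //.
rewrite -[evaluation x]/(E : dual X -> R^o).
apply/linear_bounded_continuous/linear_boundedP.
exists `|x|; split; first exact: num_real.
move=> r /ltW xr f.
by rewrite mulrC (le_trans (ler_dual_app f x))// ler_wpM2l.
Qed.

Definition canonical_embedding (x : X) : dual (dual X) :=
  Dual (evaluation_continuous_functional x).

End CanonicalEmbedding.

Section AbsSummable.
Context {R : realType}.
Implicit Types (u v : nat -> R^o).

Definition abs_summable : {pred (nat -> R^o)} :=
  fun u => `[< cvgn [normed series u] >].

Lemma abs_summableP u :
  reflect (cvgn [normed series u]) (u \in abs_summable).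
Proof. exact: asboolP. Qed.

Lemma abs_summable_submod_closed : GRing.submod_closed abs_summable.
Proof.
split.
  apply/abs_summableP; rewrite (_ : [normed series _] = cst 0).
    exact: is_cvg_cst.
  apply/funext => n; rewrite /normed_series_of /series/= big1// => i _.
  by rewrite normr0.
move=> a u v /abs_summableP cu /abs_summableP cv; apply/abs_summableP.
apply: (@series_le_cvg _ _ (`|a| *: (fun n => `|u n|) + (fun n => `|v n|))) => //.
- by move=> n; exact: normr_ge0.
- by move=> n; apply: addr_ge0 => //; apply: mulr_ge0.
- by move=> n; rewrite (le_trans (ler_normD _ _))// lerD2r normrM.
- rewrite seriesD seriesZ.
  by apply: is_cvgD => //; exact: is_cvgZl_tmp.
Qed.

HB.instance Definition _ := GRing.isSubmodClosed.Build R (nat -> R^o)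
  abs_summable abs_summable_submod_closed.

End AbsSummable.

Record ell1 (R : realType) := Ell1 {
  ell1_seq :> nat -> R^o ;
  _ : ell1_seq \in abs_summable }.

Section Ell1Norm.
Context {R : realType}.
Implicit Types (u v : ell1 R).

HB.instance Definition _ := [isSub for @ell1_seq R].
HB.instance Definition _ := [Choice of ell1 R by <:].
HB.instance Definition _ := [SubChoice_isSubLmodule of ell1 R by <:].

Lemma ell1P u v : u =1 v -> u = v.
Proof. by move=> uv; apply/val_inj/funext. Qed.

Lemma ell1_summable u : cvgn [normed series (u : nat -> R^o)].
Proof. by have /abs_summableP := valP u. Qed.

Definition ell1_norm u : R := limn [normed series (u : nat -> R^o)].

Lemma ell1_normD u v : ell1_norm (u + v) <= ell1_norm u + ell1_norm v.
Proof.
rewrite -limD; [|exact: ell1_summable..].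
apply: ler_lim; first exact: ell1_summable.
  by apply: is_cvgD; exact: ell1_summable.
near=> n; rewrite /= -[leRHS]big_split; apply: ler_sum => i _.
exact: ler_normD.
Unshelve. all: by end_near. Qed.

Lemma ell1_normZ (a : R) u : ell1_norm (a *: u) = `|a| * ell1_norm u.
Proof.
rewrite -[RHS]limZl_tmp; last exact: ell1_summable.
congr (limn _); apply/funext => n.
rewrite -[RHS]/(`|a| * \sum_(0 <= i < n) `|u i|) mulr_sumr; apply: eq_bigr => i _.
exact: normrM.
Qed.

Lemma ell1_norm0_eq0 u : ell1_norm u = 0 -> u = 0.
Proof.
move=> u0; apply: ell1P => k; apply/eqP; rewrite -normr_le0 -[leRHS]u0.
apply: le_trans (_ : [normed series (u : nat -> R^o)] k.+1 <= _).
  by rewrite /normed_series_of /series/= big_nat_recr//= lerDr sumr_ge0.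
apply: (nondecreasing_cvgn_le _ (@ell1_summable u) k.+1).
by apply: nondecreasing_series => n _ _; exact: normr_ge0.
Qed.

HB.instance Definition _ := @Lmodule_isNormed.Build R (ell1 R)
  ell1_norm ell1_normD ell1_normZ ell1_norm0_eq0.

Lemma ell1_normE u : `|u| = limn [series `|u k|]_k.
Proof. by []. Qed.

End Ell1Norm.

Definition isometrically_isomorphic {R : realType} (X Y : normedModType R) :=
  exists T : {linear X -> Y}, bijective T /\ forall x, `|T x| = `|x|.

Section Notions.
Context {R : realType}.

(* [dual (dual (dual X))] only contains bounded functionals; this is no
   restriction, since the extensions considered have a finite norm. *)
Definition Hahn_Banach_smooth (X : completeNormedModType R) :=
  forall f : dual X, exists! F : dual (dual (dual X)),
    (forall x : X, F (canonical_embedding x) = f x) /\ `|F| = `|f|.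

Definition linear_subspace (Z : normedModType R) (Y : set Z) :=
  Y 0 /\ forall (a : R) (u v : Z), Y u -> Y v -> Y (a *: u + v).

Definition annihilator (Z : normedModType R) (Y : set Z) : set (dual Z) :=
  [set f | forall y, Y y -> f y = 0].

(* The second and third clauses on [W] say that the dual of [Z] is the
   algebraic direct sum of the annihilator of [Y] and [W]; the last one that
   its norm is the l1-sum of the norms of the summands. *)
Definition M_ideal (Z : completeNormedModType R) (Y : set Z) :=
  [/\ linear_subspace Y, closed Y &
    exists W : set (dual Z),
      [/\ linear_subspace W,
          annihilator Y `&` W = [set 0],
          (forall f, exists u v, [/\ annihilator Y u, W v & f = u + v]) &
          (forall u v, annihilator Y u -> W v -> `|u + v| = `|u| + `|v|)]].

Definition M_embedded (X : completeNormedModType R) :=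
  M_ideal (range (@canonical_embedding R X)).

End Notions.

(* Main.v *)
Require Import Defs.
From HB Require Import structures.
From mathcomp Require Import all_boot all_order all_algebra.
From mathcomp Require Import all_classical all_reals all_analysis.
From mathcomp Require Import ring lra.

Set Implicit Arguments.
Unset Strict Implicit.
Unset Printing Implicit Defensive.

Import Order.TTheory GRing.Theory Num.Theory.
Import numFieldNormedType.Exports.

Local Open Scope classical_set_scope.
Local Open Scope ring_scope.

(* For 0 < r < 1, let X_r be the space of the sequences x with x_n -> r x_0,
   under the sup norm, a hyperplane of c. Its dual is l1 under the coordinate
   pairing, and the unit vectors e_n of l1 converge weak* to r e_0.

   A functional on the bidual l_oo is F = z + G, with z in l1, G vanishing on
   c_0 and |F| = |z| + |G|. On X_r, G acts as a multiple of r e_0, so that the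
   restriction of F has norm at most |z| + r |G|. If F is a norm-preserving
   extension, this forces G = 0: X_r is Hahn-Banach smooth.

   If X_r were an M-ideal in its bidual, the complement of its annihilator
   would be l1. A limit G along a free ultrafilter agrees with r e_0 on X_r, so
   |G| = |G - r e_0| + r = |G - 2 r e_0|, whereas |G - 2 r e_0| = |G| + 2 r
   since G ignores the coordinate 0.

   Finally r is an isometric invariant of X_r: it is the least bound for the
   other coordinates of a unit vector with |x_0| = 1. *)

(** * Bounded functionals and surjective isometries *)

Section BoundedFunctionals.
Context {R : realType}.

Lemma bounded_continuous_functional (X : normedModType R) (f : X -> R^o)
    (M : R) :
  linear f -> (forall x, `|f x| <= M * `|x|) -> f \in continuous_functional.
Proof.
move=> lf fM.
pose L : {linear X -> R^o} := HB.pack f (GRing.isLinear.Build R X R^o _ f lf).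
apply/continuous_functionalP; split => //.
rewrite -[f]/(L : X -> R^o).
apply/linear_bounded_continuous/linear_boundedP.
exists M; split; first exact: num_real.
by move=> r /ltW Mr x; rewrite (le_trans (fM x))// ler_wpM2r.
Qed.

Lemma dual_sumE (X : normedModType R) (I : Type) (s : seq I) (P : pred I)
    (f : I -> dual X) (x : X) :
  (\sum_(i <- s | P i) f i) x = \sum_(i <- s | P i) f i x.
Proof. by elim/big_rec2: _ => // i y g _ <-. Qed.

Lemma cvg_dual_app (X : normedModType R) (T : Type) (F : set_system T)
    (FF : Filter F) (g : T -> X) (l : X) (f : dual X) :
  g @ F --> l -> f (g t) @[t --> F] --> f l.
Proof. by move=> gl; apply: continuous_cvg => //; exact: dual_continuous. Qed.

Lemma isometry_inj (X Y : normedModType R) (T : {linear X -> Y}) :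
  (forall x, `|T x| = `|x|) -> injective T.
Proof.
move=> Tn x y Txy; apply/eqP; rewrite -subr_eq0 -normr_eq0 -Tn linearB Txy.
by rewrite subrr normr0.
Qed.

Lemma isometry_linear_inverse (X Y : normedModType R) (T : {linear X -> Y}) :
  (forall x, `|T x| = `|x|) -> (forall y, exists x, T x = y) ->
  exists2 S : {linear Y -> X}, cancel T S & cancel S T.
Proof.
move=> Tn Ts.
have [S TK SK] : bijective T.
  rewrite -setTT_bijective; split => //.
    by move=> x y _ _; exact: isometry_inj.
  by move=> y _; have [x <-] := Ts y; exists x.
have lS : linear S.
  by move=> a x y; apply: (can_inj TK); rewrite linearP !SK.
by exists (HB.pack_for {linear Y -> X} S (GRing.isLinear.Build R Y X _ S lS)).
Qed.

Lemma isometrically_isomorphic_of_surj (X Y : normedModType R)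
    (T : {linear X -> Y}) :
  (forall x, `|T x| = `|x|) -> (forall y, exists x, T x = y) ->
  isometrically_isomorphic Y X.
Proof.
move=> Tn Ts; have [S TK SK] := isometry_linear_inverse Tn Ts.
exists S; split; first by exists T.
by move=> y; rewrite -Tn SK.
Qed.

End BoundedFunctionals.

(** * Partial sums, unit vectors and truncations in l1 *)

Section Ell1.
Context {R : realType}.
Implicit Types (y : ell1 R) (N i j : nat).

Lemma normed_seriesE (u : nat -> R^o) N :
  [normed series u] N = \sum_(i < N) `|u i|.
Proof. exact: (big_mkord xpredT (fun i => `|u i|)). Qed.

Lemma ell1_partial_cvg y : \sum_(i < N) `|y i| @[N --> \oo] --> `|y|.
Proof.
rewrite (_ : (fun N => _) = [normed series (y : nat -> R^o)]).
  exact: ell1_summable.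
by apply/funext => N; rewrite normed_seriesE.
Qed.

Lemma ell1_partial_le y N : \sum_(i < N) `|y i| <= `|y|.
Proof.
rewrite -normed_seriesE.
apply: (nondecreasing_cvgn_le _ (@ell1_summable _ y)).
by apply: nondecreasing_series => n _ _; exact: normr_ge0.
Qed.

Lemma ell1_coord_le y i : `|y i| <= `|y|.
Proof.
apply: le_trans (ell1_partial_le y i.+1).
by rewrite big_ord_recr/= lerDr sumr_ge0.
Qed.

Lemma ell1_norm_le y M : (forall N, \sum_(i < N) `|y i| <= M) -> `|y| <= M.
Proof.
move=> yM; apply: (cvgr_to_le (@ell1_partial_cvg y)).
by near=> N; exact: yM.
Unshelve. all: by end_near. Qed.

Lemma bounded_abs_summable (u : nat -> R^o) (M : R) :
  (forall N, \sum_(i < N) `|u i| <= M) -> u \in abs_summable.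
Proof.
move=> uM; apply/abs_summableP; apply: nondecreasing_is_cvgn.
  by apply: nondecreasing_series => n _ _; exact: normr_ge0.
by exists M => _ [N _ <-]; rewrite normed_seriesE.
Qed.

Lemma sum_delta (a : nat -> R) j N :
  \sum_(i < N) a i * (i == j :> nat)%:R = if (j < N)%N then a j else 0.
Proof.
have [jN|Nj] := ltnP j N.
  rewrite (bigD1 (Ordinal jN))//= eqxx mulr1 big1 ?addr0// => i.
  by rewrite -val_eqE/= => /negbTE ->; rewrite mulr0.
rewrite big1// => i _; rewrite (_ : (i == j :> nat) = false) ?mulr0//.
by rewrite ltn_eqF// (leq_trans (ltn_ord i)).
Qed.

Lemma delta_seq_partial j N :
  \sum_(i < N) `|(i == j :> nat)%:R : R| <= 1.
Proof.
under eq_bigr => i _ do rewrite normr_nat -[_%:R]mul1r.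
by rewrite (sum_delta (fun=> 1)); case: ifP.
Qed.

Lemma delta_seq_abs_summable j :
  (fun i => (i == j)%:R : R^o) \in abs_summable.
Proof. by apply: bounded_abs_summable; exact: delta_seq_partial. Qed.

Definition ell1_delta j : ell1 R := Ell1 (delta_seq_abs_summable j).

Lemma ell1_delta_norm j : `|ell1_delta j| = 1.
Proof.
apply/eqP; rewrite eq_le; apply/andP; split.
  by apply: ell1_norm_le; exact: delta_seq_partial.
by rewrite (le_trans _ (ell1_coord_le _ j))//= eqxx normr1.
Qed.

Lemma ell1_sumE (I : Type) (s : seq I) (P : pred I) (y : I -> ell1 R) i :
  (\sum_(j <- s | P j) y j) i = \sum_(j <- s | P j) y j i.
Proof. by elim/big_rec2: _ => // j z g _ <-. Qed.

Definition ell1_trunc N y : ell1 R := \sum_(i < N) y i *: ell1_delta i.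

Lemma ell1_truncE N y i : ell1_trunc N y i = if (i < N)%N then y i else 0.
Proof.
rewrite ell1_sumE -(sum_delta y); apply: eq_bigr => j _.
by rewrite eq_sym.
Qed.

(** For [n >= N] the partial sums of [y - ell1_trunc N y] are those of [y] minus the first [N]
    terms. The exact value serves in [hyperplane_pairing_norm]. *)
Lemma ell1_tail_norm N y : `|y - ell1_trunc N y| = `|y| - \sum_(i < N) `|y i|.
Proof.
apply: (@cvg_unique _ (@norm_hausdorff R R^o) _ _ _ _ (@ell1_partial_cvg _)).
have : (\sum_(i < n) `|y i| - \sum_(i < N) `|y i|) @[n --> \oo] -->
    `|y| - \sum_(i < N) `|y i|.
  by apply: cvgB; [exact: ell1_partial_cvg|exact: cvg_cst].
apply: cvg_trans; apply: near_eq_cvg; near=> n.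
have Nn : (N <= n)%N by near: n; exact: nbhs_infty_ge.
have mk (z : ell1 R) m : \sum_(i < m) `|z i| = \sum_(0 <= i < m) `|z i|.
  by rewrite (big_mkord xpredT (fun i => `|z i|)).
rewrite !mk.
rewrite (big_cat_nat (n := N))//= addrAC subrr add0r.
rewrite [RHS](big_cat_nat (n := N))//= [X in _ = X + _]big_nat.
rewrite [X in _ = X + _]big1 ?add0r => [|i /andP[_ iN]].
  apply: eq_big_nat => i /andP[Ni _].
  by rewrite -[(_ - _) i]/(y i - ell1_trunc N y i) ell1_truncE ltnNge Ni subr0.
rewrite -[(_ - _) i]/(y i - ell1_trunc N y i) ell1_truncE iN.
by rewrite subrr normr0.
Unshelve. all: by end_near. Qed.

Lemma ell1_trunc_cvg y : ell1_trunc N y @[N --> \oo] --> y.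
Proof.
apply/cvgrPdist_le => e e0.
have /cvgrPdist_le /(_ e e0) := @ell1_partial_cvg y.
apply: filterS => N; rewrite ell1_tail_norm ger0_norm//.
by rewrite subr_ge0 ell1_partial_le.
Qed.

End Ell1.

(** * Norms under the canonical embedding; images of ultrafilters *)

Section CanonicalEmbeddingNorm.
Context {R : realType} {X : normedModType R}.

Lemma canonical_embedding_norm_le (x : X) : `|canonical_embedding x| <= `|x|.
Proof.
by apply: ler_dual_norm => // f; rewrite mulrC; exact: (ler_dual_app f x).
Qed.

Lemma extension_norm_ge (f : dual X) (F : dual (dual (dual X))) :
  (forall x, F (canonical_embedding x) = f x) -> `|f| <= `|F|.
Proof.
move=> Ff; apply: ler_dual_norm => // x; rewrite -Ff.
rewrite (le_trans (ler_dual_app _ _))// ler_wpM2l//.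
exact: canonical_embedding_norm_le.
Qed.

End CanonicalEmbeddingNorm.

(** The lower bound is [extension_norm_ge]: as a functional on the bidual, [canonical_embedding f]
    extends [f]. *)
Lemma canonical_embedding_dual_norm (R : realType) (X : normedModType R)
  (f : dual X) : `|canonical_embedding f| = `|f|.
Proof.
apply/eqP; rewrite eq_le canonical_embedding_norm_le/=.
exact: extension_norm_ge.
Qed.

Lemma fmap_ultra (T U : Type) (f : T -> U) (F : set_system T) :
  UltraFilter F -> UltraFilter (f @ F).
Proof.
move=> FU; have FF : ProperFilter F by exact: ultra_proper.
split=> [|G GG FG]; first exact: fmap_proper_filter.
rewrite eqEsubset; split => // A GA.
have [//|nFA] := in_ultra_setVsetC (f @^-1` A) FU.
have /(filterI GA) : G (~` A) by exact: FG.
by rewrite setICr => /filter_not_empty.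
Qed.

(** * Preduals of l1 whose unit vectors converge weak* to [r] times the first one *)

Section Ell1Predual.
Context {R : realType} (X : completeNormedModType R).
Variables (T : {linear ell1 R -> dual X}) (S : {linear dual X -> ell1 R}).
Hypotheses (TK : cancel T S) (SK : cancel S T) (Tn : forall y, `|T y| = `|y|).
Variable r : R.
Hypotheses (r_gt0 : 0 < r) (r_lt1 : r < 1).

Let d n : dual X := T (ell1_delta n).

Hypothesis d_cvg : forall x : X, d n x @[n --> \oo] --> r * d 0%N x.

Let dualX_inv_norm f : `|S f| = `|f|. Proof. by rewrite -Tn SK. Qed.

(** The truncations of [S f] converge in norm, so [phi] is determined by its coordinates
    [phi (d i)]. With the two bounds that follow, the bidual becomes a space of bounded sequences
    under the sup norm. *)
Let bidual_cvg (phi : dual (dual X)) f :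
  \sum_(i < N) S f i * phi (d i) @[N --> \oo] --> phi f.
Proof.
have -> : (fun N => \sum_(i < N) S f i * phi (d i)) =
    (fun N => phi (T (ell1_trunc N (S f)))).
  apply/funext => N; rewrite /ell1_trunc !linear_sum; apply: eq_bigr => i _.
  by rewrite !linearZ.
apply: cvg_dual_app; apply/cvgrPdist_le => e e0.
have /cvgrPdist_le /(_ e e0) := @ell1_trunc_cvg _ (S f).
by apply: filterS => N; rewrite -Tn linearB/= SK.
Qed.

Let bidual_norm_le (phi : dual (dual X)) (M : R) :
  (forall i, `|phi (d i)| <= M) -> `|phi| <= M.
Proof.
move=> phiM; have M0 : 0 <= M by exact: le_trans (phiM 0%N).
apply: ler_dual_norm => // f.
have h : `|\sum_(i < N) S f i * phi (d i)| @[N --> \oo] --> `|phi f|.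
  by apply: cvg_norm; exact: bidual_cvg.
apply: (cvgr_to_le h); near=> N.
rewrite (le_trans (ler_norm_sum _ _ _))// -dualX_inv_norm.
rewrite (le_trans _ (ler_wpM2l M0 (ell1_partial_le (S f) N)))//.
rewrite mulr_sumr; apply: ler_sum => i _.
by rewrite normrM mulrC ler_wpM2r.
Unshelve. all: by end_near. Qed.

Let bidual_coord_le (phi : dual (dual X)) i : `|phi (d i)| <= `|phi|.
Proof.
rewrite (le_trans (ler_dual_app _ _))// Tn ell1_delta_norm.
by rewrite mulr1.
Qed.

Let coord_functional i : (fun f => S f i : R^o) \in continuous_functional.
Proof.
apply: (@bounded_continuous_functional _ _ _ 1) => [a f g|f].
  by rewrite linearP.
by rewrite mul1r -dualX_inv_norm ell1_coord_le.
Qed.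

(** The coordinate functionals of l1, that is, the unit vectors of l_oo. *)
Let E i : dual (dual X) := Dual (coord_functional i).

Let Ed i j : E i (d j) = (i == j)%:R.
Proof. by rewrite /d /E/= TK. Qed.

(** * Uniqueness of norm-preserving extensions *)

Section Smoothness.
Variable F : dual (dual (dual X)).

(* Test [F] on the element of the bidual whose coordinates are [b * sg (F e_i)]
   for [i < N] and those of [phi], up to a global sign, afterwards. *)
Let truncated_norm_le (phi : dual (dual X)) N (b : R) : 0 <= b ->
    (forall i, (N <= i)%N -> `|phi (d i)| <= b) ->
  \sum_(i < N) `|F (E i)| * b + `|F phi - \sum_(i < N) F (E i) * phi (d i)|
    <= `|F| * b.
Proof.
move=> b0 phib.
set G := F phi - _; pose s := Num.sg G.
pose a i := b * Num.sg (F (E i)) - s * phi (d i).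
pose psi := \sum_(i < N) a i *: E i + s *: phi.
have psid j : psi (d j) =
    if (j < N)%N then b * Num.sg (F (E j)) else s * phi (d j).
  have -> : psi (d j) = \sum_(i < N) a i * (i == j :> nat)%:R + s * phi (d j).
    rewrite -[LHS]/((\sum_(i < N) a i *: E i) (d j) + s * phi (d j)).
    rewrite dual_sumE; congr (_ + _); apply: eq_bigr => i _.
    by rewrite -Ed.
  by rewrite sum_delta; case: ifP => _; rewrite /a ?add0r// subrK.
have psib : `|psi| <= b.
  apply: bidual_norm_le => j; rewrite psid; case: ltnP => [jN|Nj].
    by rewrite normrM (ger0_norm b0) ler_piMr// normr_sg; case: eqP.
  rewrite normrM (le_trans _ (phib _ Nj))// ler_piMl//.
  by rewrite normr_sg; case: eqP.
have <- : F psi =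
    \sum_(i < N) `|F (E i)| * b + `|G|.
  rewrite linearD linear_sum linearZ/= -[s *: F phi]/(s * F phi).
  have -> : F phi = G + \sum_(i < N) F (E i) * phi (d i) by rewrite subrK.
  rewrite mulrDr -normrEsg addrCA addrC; congr (_ + _).
  rewrite mulr_sumr -big_split/=; apply: eq_bigr => i _.
  rewrite linearZ/= -[a i *: _]/(a i * F (E i)) /a [in RHS]normrEsg.
  ring.
rewrite (le_trans (ler_norm _))// (le_trans (ler_dual_app _ _))//.
by rewrite ler_wpM2l.
Qed.

Let coeff_partial_le N : \sum_(i < N) `|F (E i)| <= `|F|.
Proof.
have := @truncated_norm_le 0 N 1 ler01.
rewrite mulr1 => /(_ _)/(le_trans _)-> => [//||i _].
  rewrite -[leLHS]addr0 lerD//; apply: ler_sum => i _; rewrite mulr1//.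
by rewrite -[(0 : dual (dual X)) _]/(0 : R) normr0.
Qed.

Let coeff_summable : (fun i => F (E i)) \in abs_summable.
Proof. exact: bounded_abs_summable coeff_partial_le. Qed.

(** The l1 part of [F]. The remainder, called singular below, vanishes on every [E i]. *)
Let z : ell1 R := Ell1 coeff_summable.

(** The limit of [truncated_norm_le] over the number of terms. It says both that the singular part
    has norm at most |F| - |z| and that it sees only the tail of [phi]. *)
Let singular_part_le (phi : dual (dual X)) N (b : R) : 0 <= b ->
    (forall i, (N <= i)%N -> `|phi (d i)| <= b) ->
  `|F phi - phi (T z)| <= (`|F| - `|z|) * b.
Proof.
move=> b0 phib; rewrite mulrBl lerBrDl.
have h : \sum_(i < n) `|z i| * b + `|F phi - \sum_(i < n) z i * phi (d i)|
   @[n --> \oo] --> `|z| * b + `|F phi - phi (T z)|.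
  apply: cvgD.
    have -> : (fun n => \sum_(i < n) `|z i| * b) =
        (fun n => (\sum_(i < n) `|z i|) * b).
      by apply/funext => n; rewrite mulr_suml.
    by apply: cvgM; [exact: ell1_partial_cvg|exact: cvg_cst].
  apply: cvg_norm; apply: cvgB; first exact: cvg_cst.
  by have := @bidual_cvg phi (T z); rewrite TK.
apply: (cvgr_to_le h); near=> n.
apply: truncated_norm_le => // i ni; apply: phib; apply: leq_trans ni.
by near: n; exact: nbhs_infty_ge.
Unshelve. all: by end_near. Qed.

Lemma norm_preserving_extension_unique (f : dual X) :
  (forall x, F (canonical_embedding x) = f x) -> `|F| = `|f| ->
  F = canonical_embedding f.
Proof.
move=> Ff Fn.
have g0 : 0 <= `|F| - `|z|.
  by rewrite subr_ge0; apply: ell1_norm_le; exact: coeff_partial_le.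
(* For [x] in [X] the tail coordinates approach [r * d 0%N x], of modulus at most r |x|, so the
   singular part is damped by the factor [r] on [X]. *)
have Fx x : `|f x - T z x| <= (`|F| - `|z|) * (r * `|x|).
  rewrite -Ff -[T z x]/(canonical_embedding x (T z)).
  apply/ler_addgt0Pr => e e0.
  (* The [+ 1] keeps the denominator positive when |F| = |z|. *)
  have e'0 : 0 < e / (`|F| - `|z| + 1) by rewrite divr_gt0// ltr_wpDl.
  have /cvgrPdist_le /(_ _ e'0) [N _ Ne] := @d_cvg x.
  have rx0 : 0 <= r * `|x| by rewrite mulr_ge0// ltW.
  apply: (le_trans (@singular_part_le _ N (r * `|x| +
      e / (`|F| - `|z| + 1)) _ _)) => [|i Ni|].
  - by rewrite addr_ge0// ltW.
  - have := Ne i Ni; rewrite /= distrC => h.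
    rewrite -[_ (d i)]/(d i x) -(subrK (r * d 0%N x) (d i x)) addrC.
    rewrite (le_trans (ler_normD _ _))// lerD//.
    rewrite normrM (gtr0_norm r_gt0) ler_wpM2l//; first exact: ltW.
    by rewrite (le_trans (ler_dual_app _ _))// Tn ell1_delta_norm mul1r.
  - rewrite mulrDr lerD2l mulrA ler_pdivrMr ?ltr_wpDl// mulrC ler_wpM2l//.
      exact: ltW.
    by rewrite lerDl.
have fn : `|f| <= `|z| + (`|F| - `|z|) * r.
  apply: ler_dual_norm => [|x].
    by rewrite addr_ge0// mulr_ge0// ltW.
  rewrite -(subrK (T z x) (f x)) addrC mulrDl.
  rewrite (le_trans (ler_normD _ _))// lerD// -?mulrA// -Tn.
  exact: ler_dual_app.
(* Since |F| = |f|, the bound [fn] turns into this one, and [r < 1] then kills the singular part. *)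
have gr : (`|F| - `|z|) * (1 - r) <= 0 by rewrite -Fn in fn; lra.
have gE : `|F| - `|z| = 0.
  apply/eqP; rewrite eq_le g0 andbT.
  by rewrite pmulr_lle0 ?subr_gt0 in gr.
have fE : f = T z.
  apply: dualP => x; apply/eqP; rewrite -subr_eq0 -normr_le0.
  by rewrite (le_trans (Fx x))// gE mul0r.
apply: dualP => phi; apply/eqP; rewrite -subr_eq0 -normr_le0.
rewrite -[canonical_embedding f phi]/(phi f) fE.
rewrite (le_trans (@singular_part_le phi 0%N `|phi| _ _)) ?gE ?mul0r//.
Qed.

End Smoothness.

Lemma ell1_predual_Hahn_Banach_smooth : Hahn_Banach_smooth X.
Proof.
move=> f; exists (canonical_embedding f); split.
  by split => //; exact: canonical_embedding_dual_norm.
by move=> F [Ff Fn]; rewrite (norm_preserving_extension_unique Ff Fn).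
Qed.

(** * Failure of M-embedding *)

Let limit_functional : exists G : dual (dual (dual X)),
  (forall i, G (E i) = 0) /\
  forall x, G (canonical_embedding x) = r * d 0%N x.
Proof.
(* [G] is the limit of the coordinates along an ultrafilter refining [\oo]: it ignores any single
   coordinate and equals the ordinary limit when there is one. *)
have [U [UU ooU]] := @ultraFilterLemma nat \oo _.
have lcvg (phi : dual (dual X)) : cvg (phi (d n) @[n --> U]).
  (* The coordinates stay in a compact segment, hence converge along [U]. *)
  have := @segment_compact R (- `|phi|) `|phi|.
  rewrite compact_ultra => /(_ (phi (d n) @[n --> U])) [||l [_ phil]].
  - exact: fmap_ultra.
  - apply: (@filterE nat U _) => n /=; rewrite in_itv/= -ler_norml.
    exact: bidual_coord_le.
  - by apply/cvg_ex; exists l.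
pose l (phi : dual (dual X)) : R^o := lim (phi (d n) @[n --> U]).
have lE (phi : dual (dual X)) (a : R^o) :
    phi (d n) @[n --> \oo] --> a -> l phi = a.
  move=> phia; apply: (@cvg_lim R^o); first exact: norm_hausdorff.
  by apply: cvg_trans phia; apply: cvg_app.
have ll : linear l.
  move=> a phi psi; apply: (@cvg_lim R^o); first exact: norm_hausdorff.
  by apply: cvgD; [apply: cvgZl_tmp; exact: lcvg|exact: lcvg].
have lM phi : `|l phi| <= 1 * `|phi|.
  have h : `|phi (d n)| @[n --> U] --> `|l phi|.
    by apply: cvg_norm; exact: lcvg.
  rewrite mul1r; apply: (cvgr_to_le h).
  by near=> n; exact: bidual_coord_le.
exists (Dual (bounded_continuous_functional ll lM)); split => [i|x].
  apply: lE; apply: cvg_near_cst; near=> n.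
  rewrite Ed ltn_eqF//; near: n; exact: nbhs_infty_gt.
by apply: lE; exact: d_cvg.
Unshelve. all: by end_near. Qed.

Lemma ell1_predual_not_M_embedded : ~ M_embedded X.
Proof.
case=> _ _ [W [[W0 Wl] _ Wsum Wn]].
(* The component [w] of [canonical_embedding f] still extends [f], so |w| >= |f| = |u| + |w| and [u]
   vanishes. *)
have JW (f : dual X) : W (canonical_embedding f).
  have [u [w [Au Ww fE]]] := Wsum (canonical_embedding f).
  have wf x : w (canonical_embedding x) = f x.
    have := congr1 (fun h : dual (dual (dual X)) => h (canonical_embedding x))
      fE.
    rewrite -[(u + w) _]/(u (canonical_embedding x) + w _).
    by rewrite Au ?add0r => [<-//|]; exists x.
  have u0 : u = 0.
    apply/eqP; rewrite -normr_le0.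
    have := Wn _ _ Au Ww; rewrite -fE canonical_embedding_dual_norm.
    by have := extension_norm_ge wf; lra.
  by rewrite fE u0 add0r.
have [G [GE GJ]] := limit_functional.
(* [G] and [r *: D] agree on [X], so [H] is in the annihilator, and the l1-sum gives equal norms to
   [H + r *: D], which is [G], and to [H - r *: D]. *)
pose D := canonical_embedding (d 0%N); pose H := G - r *: D.
have AH : annihilator (range (@canonical_embedding R X)) H.
  move=> _ [x _ <-]; rewrite -[H _]/(G _ - r * d 0%N x) GJ.
  by rewrite subrr.
have WD a : W (a *: D) by rewrite -[_ *: _]addr0; apply: Wl; [exact: JW|].
have nD : `|D| = 1.
  by rewrite canonical_embedding_dual_norm Tn ell1_delta_norm.
have h1 : `|G| = `|H| + r.
  by have := Wn _ _ AH (WD r); rewrite subrK normrZ nD mulr1 gtr0_norm.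
have h2 : `|H - r *: D| = `|H| + r.
  have := Wn _ _ AH (WD (- r)); rewrite scaleNr normrN normrZ nD mulr1.
  by rewrite gtr0_norm.
have h3 phi : `|G phi| <= (`|G| - 2 * r) * `|phi|.
  wlog Gphi : phi / 0 <= G phi.
    move=> hw; have [/hw//|/ltW Gphi] := leP 0 (G phi).
    by have := hw (- phi); rewrite linearN !normrN oppr_ge0; exact.
  (* [psi] is [phi] with coordinate 0 replaced by -|phi|. The norm does not grow and [G] does not
     notice, but [H - r *: D], being [G - 2 r D], gains 2 r |phi|. *)
  pose psi := phi - (phi (d 0%N) + `|phi|) *: E 0%N.
  have psi0 j : psi (d j) = if j == 0%N then - `|phi| else phi (d j).
    rewrite -[psi _]/(phi (d j) - (phi (d 0%N) + `|phi|) * E 0%N (d j)).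
    rewrite Ed; case: j => [|j]/=; last by rewrite mulr0 subr0.
    by rewrite mulr1 opprD addrA subrr add0r.
  have psin : `|psi| <= `|phi|.
    apply: bidual_norm_le => j; rewrite psi0; case: eqP => _.
      by rewrite normrN normr_id.
    exact: bidual_coord_le.
  have : `|(H - r *: D) psi| <= (`|H| + r) * `|phi|.
    by rewrite (le_trans (ler_dual_app _ _))// h2 ler_wpM2l// -h1.
  have -> : (H - r *: D) psi = G phi + 2 * r * `|phi|.
    rewrite -[LHS]/(G psi - r * psi (d 0%N) - r * psi (d 0%N)).
    have -> : G psi = G phi by rewrite linearB linearZ/= GE scaler0 subr0.
    rewrite psi0 eqxx; ring.
  rewrite ger0_norm; last by rewrite addr_ge0// !mulr_ge0// ltW.
  by rewrite (ger0_norm Gphi) -h1; lra.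
have : `|G| <= `|G| - 2 * r.
  apply: ler_dual_norm => //.
  (* [ler_dual_norm] asks for a nonnegative bound, which is [h3] at the nonzero vector [E 0%N]. *)
  have E0 : 0 < `|E 0%N|.
    rewrite (lt_le_trans ltr01)// (le_trans _ (bidual_coord_le _ 0%N))//.
    by rewrite Ed normr1.
  by rewrite -(pmulr_lge0 _ E0) (le_trans _ (h3 _)).
by rewrite leNgt ltrBlDr ltrDl mulr_gt0.
Qed.

End Ell1Predual.

(** * The Banach space X_r *)

Section Hyperplane.
Context {R : realType} (r : R).

Definition limit_scaled_head : {pred (nat -> R^o)} :=
  fun x => `[< x n @[n --> \oo] --> (r * x 0%N : R^o) >].

Lemma limit_scaled_headP (x : nat -> R^o) :
  reflect (x n @[n --> \oo] --> (r * x 0%N : R^o)) (x \in limit_scaled_head).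
Proof. exact: asboolP. Qed.

Lemma limit_scaled_head_submod_closed :
  GRing.submod_closed limit_scaled_head.
Proof.
split; first by apply/limit_scaled_headP; rewrite mulr0; exact: cvg_cst.
move=> a x y /limit_scaled_headP cx /limit_scaled_headP cy.
apply/limit_scaled_headP; rewrite mulrDr.
have -> : r * (a *: x) 0%N = a *: (r * x 0%N : R^o).
  by rewrite -[(a *: x) 0%N]/(a * x 0%N) mulrCA.
by apply: cvgD => //; exact: cvgZl_tmp.
Qed.

HB.instance Definition _ := GRing.isSubmodClosed.Build R (nat -> R^o)
  limit_scaled_head limit_scaled_head_submod_closed.

End Hyperplane.

Record hyperplane {R : realType} (r : R) := Hyperplane {
  hyperplane_seq :> nat -> R^o ;
  _ : hyperplane_seq \in limit_scaled_head r }.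

Section HyperplaneNorm.
Context {R : realType} (r : R).
Implicit Types x y : hyperplane r.

HB.instance Definition _ := [isSub for @hyperplane_seq R r].
HB.instance Definition _ := [Choice of hyperplane r by <:].
HB.instance Definition _ := [SubChoice_isSubLmodule of hyperplane r by <:].

Lemma hyperplaneP x y : x =1 y -> x = y.
Proof. by move=> xy; apply/val_inj/funext. Qed.

Lemma hyperplane_cvg x : x n @[n --> \oo] --> (r * x 0%N : R^o).
Proof. by have /limit_scaled_headP := valP x. Qed.

Definition hyperplane_norm x : R := sup (range (fun n => `|x n|)).

Lemma hyperplane_has_sup x : has_sup (range (fun n => `|x n|)).
Proof.
split; first by exists `|x 0%N|; exists 0%N.
have cx : cvgn (x : nat -> R^o).
  by apply/cvg_ex; exists (r * x 0%N); exact: hyperplane_cvg.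
have /pinfty_ex_gt0 [M _ xM] := cvg_seq_bounded cx.
by exists M => _ [n _ <-]; exact: xM.
Qed.

Lemma hyperplane_coord_le x n : `|x n| <= hyperplane_norm x.
Proof.
by apply: sup_upper_bound; [exact: hyperplane_has_sup|exists n].
Qed.

Lemma hyperplane_norm_leP x (M : R) :
  (forall n, `|x n| <= M) -> hyperplane_norm x <= M.
Proof.
move=> xM; apply: ge_sup; first by have [] := hyperplane_has_sup x.
by move=> _ [n _ <-].
Qed.

Lemma hyperplane_normD x y :
  hyperplane_norm (x + y) <= hyperplane_norm x + hyperplane_norm y.
Proof.
apply: hyperplane_norm_leP => n; rewrite (le_trans (ler_normD _ _))//.
by rewrite lerD// hyperplane_coord_le.
Qed.

Lemma hyperplane_normZ (a : R) x :
  hyperplane_norm (a *: x) = `|a| * hyperplane_norm x.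
Proof.
have le_Z (b : R) z : hyperplane_norm (b *: z) <= `|b| * hyperplane_norm z.
  apply: hyperplane_norm_leP => n; rewrite [leLHS]normrM ler_wpM2l//.
  exact: hyperplane_coord_le.
apply/eqP; rewrite eq_le le_Z/=.
have [->|a0] := eqVneq a 0.
  by rewrite normr0 mul0r (le_trans _ (hyperplane_coord_le _ 0%N)).
rewrite -[in leLHS](scalerK a0 x) -ler_pdivlMl ?normr_gt0// -normfV.
exact: le_Z.
Qed.

Lemma hyperplane_norm0_eq0 x : hyperplane_norm x = 0 -> x = 0.
Proof.
move=> x0; apply: hyperplaneP => n; apply/eqP; rewrite -normr_le0 -x0.
exact: hyperplane_coord_le.
Qed.

HB.instance Definition _ := @Lmodule_isNormed.Build R (hyperplane r)
  hyperplane_norm hyperplane_normD hyperplane_normZ hyperplane_norm0_eq0.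

Lemma hyperplane_app_le x n : `|x n| <= `|x|.
Proof. exact: hyperplane_coord_le. Qed.

Lemma hyperplane_norm_le x (M : R) : (forall n, `|x n| <= M) -> `|x| <= M.
Proof. exact: hyperplane_norm_leP. Qed.

Lemma hyperplane_complete (F : set_system (hyperplane r)) :
  ProperFilter F -> cauchy F -> cvg F.
Proof.
move=> FF /cauchyP Fc.
have Fe (e : R) : 0 < e ->
    exists y : hyperplane r, \forall x \near F, `|y - x| < e.
  move=> e0; have [y Fy] := Fc e e0; exists y; near=> x.
  by have : ball y e x by near: x; exact: Fy.
have pcvg n : cvg ((fun x : hyperplane r => x n) @ F).
  apply: cauchy_cvg; apply: cauchy_exP => e e0.
  have [y Fy] := Fe e e0.
  exists (y n); apply: (filterS _ Fy) => x yx.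
  by rewrite /ball/= (le_lt_trans (hyperplane_app_le (y - x) n)).
pose l n : R^o := lim ((fun x : hyperplane r => x n) @ F).
have lcvg n : (fun x : hyperplane r => x n) @ F --> l n by exact: pcvg.
have lb y e : (\forall x \near F, `|y - x| < e) -> forall n, `|y n - l n| <= e.
  move=> yF n.
  have yl : (fun x : hyperplane r => `|y n - x n|) @ F --> `|y n - l n|.
    by apply: cvg_norm; apply: cvgB; [exact: cvg_cst|exact: lcvg].
  apply: (cvgr_to_le yl).
  near=> x; rewrite /= (le_trans (hyperplane_app_le (y - x) n))//.
  by apply: ltW; near: x.
have lP : l \in limit_scaled_head r.
  apply/limit_scaled_headP/cvgrPdist_le => e e0.
  (* Three errors occur below, with weights |r|, 1 and 1; hence the divisor. *)
  have d0 : 0 < e / (`|r| + 2) by rewrite divr_gt0// ltr_wpDl.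
  have [y /lb yl] := Fe _ d0.
  have /cvgrPdist_le /(_ _ d0) := @hyperplane_cvg y.
  apply: filterS => n yn.
  rewrite (_ : r * l 0%N - l n = - (r * (y 0%N - l 0%N))
    + ((r * y 0%N - y n) + (y n - l n))); last by ring.
  rewrite (le_trans (ler_normD _ _))//.
  rewrite normrN normrM.
  have -> : e = `|r| * (e / (`|r| + 2)) +
      (e / (`|r| + 2) + e / (`|r| + 2)).
    by field; rewrite gt_eqF// ltr_wpDl.
  rewrite lerD ?ler_wpM2l// (le_trans (ler_normD _ _))// lerD//.
apply/cvg_ex; exists (Hyperplane lP); apply/cvgrPdist_le => e e0.
have e20 : 0 < e / 2 by rewrite divr_gt0.
have [y yF] := Fe (e / 2) e20; near=> x.
rewrite -(subrK y (Hyperplane lP)) -addrA (le_trans (ler_normD _ _))//.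
rewrite (splitr e) lerD//; last by apply: ltW; near: x.
apply: hyperplane_norm_le => n.
rewrite (_ : (Hyperplane lP - y) n = l n - y n)// distrC.
exact: lb.
Unshelve. all: by end_near. Qed.

HB.instance Definition _ :=
  Uniform_isComplete.Build (hyperplane r) hyperplane_complete.

Lemma head_tail_in (a : nat -> R) N :
  (fun n => if (n <= N)%N then a n else r * a 0%N) \in limit_scaled_head r.
Proof.
apply/limit_scaled_headP => /=; apply: cvg_near_cst; near=> n.
rewrite leqNgt; have -> : (N < n)%N by near: n; exact: nbhs_infty_gt.
by [].
Unshelve. all: by end_near. Qed.

(** Filling the tail with [r * a 0%N] keeps the sequence in the space, whatever values are
    prescribed at 0, ..., N. *)
Definition hyperplane_trunc N (a : nat -> R) : hyperplane r :=
  Hyperplane (head_tail_in a N).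

Lemma hyperplane_truncE N a n :
  hyperplane_trunc N a n = if (n <= N)%N then a n else r * a 0%N.
Proof. by []. Qed.

Lemma delta_succ_in k :
  (fun n => (n == k.+1)%:R : R^o) \in limit_scaled_head r.
Proof.
apply/limit_scaled_headP => /=; rewrite mulr0; apply: cvg_near_cst.
near=> n; rewrite gtn_eqF//; near: n; exact: nbhs_infty_gt.
Unshelve. all: by end_near. Qed.

(** The index is shifted because the unit vector at coordinate 0 tends to 0 instead of [r], and so
    lies outside the space when [r] is nonzero. *)
Definition hyperplane_delta k : hyperplane r := Hyperplane (delta_succ_in k).

Lemma hyperplane_truncS N a :
  hyperplane_trunc N.+1 a =
    hyperplane_trunc N a + (a N.+1 - r * a 0%N) *: hyperplane_delta N.
Proof.
apply: hyperplaneP => n.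
rewrite -[RHS]/(hyperplane_trunc N a n + (a N.+1 - r * a 0%N) *
  (n == N.+1)%:R) !hyperplane_truncE.
case: (ltngtP n N.+1) => [nN|Nn|->].
- by rewrite -ltnS nN mulr0 addr0.
- by rewrite leqNgt (ltnW Nn) mulr0 addr0.
- by rewrite ltnn mulr1 addrC subrK.
Qed.

Lemma hyperplane_trunc_norm_le N (a : nat -> R) (M : R) : `|r| <= 1 ->
  (forall n, (n <= N)%N -> `|a n| <= M) -> `|hyperplane_trunc N a| <= M.
Proof.
move=> r1 aM; apply: hyperplane_norm_le => n.
rewrite hyperplane_truncE; case: ifP => [/aM//|_].
rewrite normrM (le_trans _ (aM 0%N _))// ler_piMl//.
Qed.

(** Beyond the cut the error is [x n - r * x 0%N], small uniformly in [n]. *)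
Lemma hyperplane_trunc_cvg x : hyperplane_trunc N x @[N --> \oo] --> x.
Proof.
apply/cvgrPdist_le => e e0.
have /cvgrPdist_le /(_ _ e0) [N _ xN] := @hyperplane_cvg x.
exists N => // m Nm; apply: hyperplane_norm_le => n.
rewrite (_ : (x - hyperplane_trunc m x) n = x n - hyperplane_trunc m x n)//.
rewrite hyperplane_truncE.
case: leqP => [_|mn]; first by rewrite subrr normr0 ltW.
by rewrite distrC; apply: xN; rewrite /= (leq_trans Nm)// ltnW.
Qed.

End HyperplaneNorm.

(** * The dual of X_r is l1 *)

Section HyperplaneDual.
Context {R : realType} (r : R).
Hypothesis r_le1 : `|r| <= 1.
Local Notation X := (hyperplane r).

Lemma hyperplane_coord_functional n :
  (fun x : X => x n : R^o) \in continuous_functional.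
Proof.
apply: (@bounded_continuous_functional _ _ _ 1) => // x.
by rewrite mul1r hyperplane_app_le.
Qed.

Definition hyperplane_coord n : dual X := Dual (hyperplane_coord_functional n).

Lemma hyperplane_coord_norm_le n : `|hyperplane_coord n| <= 1.
Proof.
by apply: ler_dual_norm => // x; rewrite mul1r; exact: hyperplane_app_le.
Qed.

Let pairing_summable (y : ell1 R) :
  cvgn (series (fun i => y i *: hyperplane_coord i)).
Proof.
apply: normed_cvg.
apply: (@series_le_cvg _ _ (fun i => `|y i|)) => [n|n|n|].
- exact: normr_ge0.
- exact: normr_ge0.
- by rewrite /= normrZ ler_piMr// hyperplane_coord_norm_le.
- exact: ell1_summable.
Qed.

(** Taking a norm-convergent series in the complete space [dual X] makes continuity of the pairing
    automatic. *)
Definition hyperplane_pairing (y : ell1 R) : dual X :=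
  limn (series (fun i => y i *: hyperplane_coord i)).

Lemma hyperplane_pairing_cvg (y : ell1 R) (x : X) :
  \sum_(i < N) y i * x i @[N --> \oo] --> hyperplane_pairing y x.
Proof.
have -> : (fun N => \sum_(i < N) y i * x i) =
    (fun N => series (fun i => y i *: hyperplane_coord i) N x).
  by apply/funext => N; rewrite dual_sumE big_mkord.
apply: (@cvg_dual_app _ _ _ _ _ (series (fun i => y i *: hyperplane_coord i))
  _ (canonical_embedding x)).
exact: pairing_summable.
Qed.

Lemma hyperplane_pairing_linear : linear hyperplane_pairing.
Proof.
move=> a y z; apply: dualP => x.
apply: (@cvg_unique _ (@norm_hausdorff R R^o) _ _ _ _
  (@hyperplane_pairing_cvg _ _)).
have -> : (fun N => \sum_(i < N) (a *: y + z : ell1 R) i * x i) =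
    (fun N => a *: (\sum_(i < N) y i * x i : R^o) + \sum_(i < N) z i * x i).
  apply/funext => N; rewrite scaler_sumr -big_split/=; apply: eq_bigr => i _.
  by rewrite -[LHS]/((a * y i + z i) * x i) mulrDl -mulrA.
by apply: cvgD; [apply: cvgZl_tmp|]; exact: hyperplane_pairing_cvg.
Qed.

HB.instance Definition _ := GRing.isLinear.Build R (ell1 R) (dual X) _
  hyperplane_pairing hyperplane_pairing_linear.

Lemma hyperplane_pairing_delta n :
  hyperplane_pairing (ell1_delta n) = hyperplane_coord n.
Proof.
apply: dualP => x.
apply: (@cvg_unique _ (@norm_hausdorff R R^o) _ _ _ _
  (@hyperplane_pairing_cvg _ _)).
apply: cvg_near_cst; near=> N.
under eq_bigr do rewrite mulrC.
rewrite (sum_delta x); have -> : (n < N)%N by near: N; exact: nbhs_infty_gt.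
by [].
Unshelve. all: by end_near. Qed.

Lemma hyperplane_pairing_norm_le (y : ell1 R) :
  `|hyperplane_pairing y| <= `|y|.
Proof.
apply: ler_dual_norm => // x.
have h : `|\sum_(i < N) y i * x i| @[N --> \oo] --> `|hyperplane_pairing y x|.
  by apply: cvg_norm; exact: hyperplane_pairing_cvg.
apply: (cvgr_to_le h); near=> N; rewrite (le_trans (ler_norm_sum _ _ _))//.
rewrite (le_trans _ (ler_wpM2r _ (ell1_partial_le y N)))// mulr_suml.
by apply: ler_sum => i _; rewrite normrM ler_wpM2l// hyperplane_app_le.
Unshelve. all: by end_near. Qed.

Lemma hyperplane_pairing_norm (y : ell1 R) : `|hyperplane_pairing y| = `|y|.
Proof.
apply/eqP; rewrite eq_le hyperplane_pairing_norm_le/=.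
(* On the signs of the first coordinates, the pairing is at least the [N]-th partial sum minus the
   tail, and the tail is |y| minus the same sum; hence the factor 2. *)
suff h N : (\sum_(i < N) `|y i|) *+ 2 <= `|hyperplane_pairing y| + `|y|.
  have : `|y| <= (`|hyperplane_pairing y| + `|y|) / 2.
    by apply: ell1_norm_le => N; have := h N; lra.
  by lra.
pose x := hyperplane_trunc r N (fun n => Num.sg (y n)).
have x1 : `|x| <= 1.
  by apply: hyperplane_trunc_norm_le => // n _; rewrite normr_sg; case: eqP.
have yNx : hyperplane_pairing (ell1_trunc N y) x = \sum_(i < N) `|y i|.
  rewrite linear_sum dual_sumE; apply: eq_bigr => i _.
  rewrite linearZ/= hyperplane_pairing_delta.
  rewrite -[LHS]/(y i * x i) hyperplane_truncE ltnW// normrEsg mulrC.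
  by [].
have yx : hyperplane_pairing (y - ell1_trunc N y) x =
    hyperplane_pairing y x - \sum_(i < N) `|y i|.
  by rewrite -yNx linearB.
have le1 (f : dual X) : `|f x| <= `|f|.
  by rewrite (le_trans (ler_dual_app _ _))// ler_piMr.
have := le1 (hyperplane_pairing y).
have := le_trans (le1 _) (hyperplane_pairing_norm_le (y - ell1_trunc N y)).
rewrite yx ell1_tail_norm mulr2n !ler_norml; lra.
Qed.

(** Start from a multiple of (1, r, r, ...) and correct the coordinates 1, ..., N one at a time by
    [hyperplane_truncS]. *)
Lemma hyperplane_functional_trunc (f : dual X) N (a : nat -> R) :
  f (hyperplane_trunc r N a) = a 0%N * f (hyperplane_trunc r 0 (fun=> 1)) +
    \sum_(i < N) (a i.+1 - r * a 0%N) * f (hyperplane_delta r i).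
Proof.
elim: N => [|N IH].
  rewrite big_ord0 addr0.
  suff -> : hyperplane_trunc r 0 a = a 0%N *: hyperplane_trunc r 0 (fun=> 1).
    by rewrite linearZ.
  apply: hyperplaneP => n; rewrite -[RHS]/(a 0%N * hyperplane_trunc r 0 _ n).
  rewrite !hyperplane_truncE leqn0; case: eqP => [->|_]; ring.
rewrite hyperplane_truncS linearD linearZ/= IH big_ord_recr/= addrA.
by [].
Qed.

Lemma hyperplane_pairing_surj (f : dual X) : exists y, hyperplane_pairing y = f.
Proof.
(* No unit vector tests coordinate 0: it gets the placeholder 0, corrected at the end by [g1]. *)
pose u n := if n is m.+1 then f (hyperplane_delta r m) else 0.
have uS : (u : nat -> R^o) \in abs_summable.
  apply: (@bounded_abs_summable _ _ `|f|) => -[|N].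
    by rewrite big_ord0.
  (* The head 0 makes the tail of the truncation vanish, so only unit vectors contribute. *)
  pose a n := if n is m.+1 then Num.sg (u n) else 0 : R.
  have -> : \sum_(i < N.+1) `|u i| = f (hyperplane_trunc r N a).
    rewrite hyperplane_functional_trunc mul0r add0r.
    rewrite big_ord_recl normr0 add0r; apply: eq_bigr => i _.
    by rewrite mulr0 subr0 -normrEsg.
  rewrite (le_trans (ler_norm _))// (le_trans (ler_dual_app _ _))// ler_piMr//.
  apply: hyperplane_trunc_norm_le => // -[|n] _; rewrite ?normr0//.
  by rewrite normr_sg; case: eqP.
pose g := f - hyperplane_pairing (Ell1 uS).
have gd k : g (hyperplane_delta r k) = 0.
  rewrite -[LHS]/(f (hyperplane_delta r k) - hyperplane_pairing (Ell1 uS)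
    (hyperplane_delta r k)).
  apply/eqP; rewrite subr_eq0; apply/eqP/esym.
  apply: (@cvg_unique _ (@norm_hausdorff R R^o) _ _ _ _
    (@hyperplane_pairing_cvg _ _)).
  apply: cvg_near_cst; near=> N; rewrite (sum_delta u).
  by have -> : (k.+1 < N)%N by near: N; exact: nbhs_infty_gt.
(* As [g] vanishes on the unit vectors, it is [g1] times coordinate 0 on truncations, hence
   everywhere by density. *)
pose g1 := g (hyperplane_trunc r 0 (fun=> 1)).
exists (Ell1 uS + g1 *: ell1_delta 0).
rewrite linearD linearZ/= hyperplane_pairing_delta.
rewrite -[RHS](subrK (hyperplane_pairing (Ell1 uS))) -/g addrC.
congr (_ + _); apply: dualP => x.
have gx : g (hyperplane_trunc r N x) @[N --> \oo] --> g x.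
  by apply: cvg_dual_app; exact: hyperplane_trunc_cvg.
apply: (@cvg_unique _ (@norm_hausdorff R R^o) _ _ _ _ _ gx).
apply: cvg_near_cst; near=> N; rewrite hyperplane_functional_trunc -/g1.
by rewrite big1 ?addr0 1?mulrC// => i _; rewrite gd mulr0.
Unshelve. all: by end_near. Qed.

Lemma hyperplane_dual_ell1 : isometrically_isomorphic (dual X) (ell1 R).
Proof.
apply: (@isometrically_isomorphic_of_surj _ _ _ hyperplane_pairing).
  exact: hyperplane_pairing_norm.
exact: hyperplane_pairing_surj.
Qed.

End HyperplaneDual.

(** * Recovering r from the isometry class of X_r *)

Section HyperplaneIndex.
Context {R : realType}.

(** By convexity, the norm is affine along every diameter of the ball of radius [c] centred at the
    unit vector [x]. *)
Definition flat (X : normedModType R) (c : R) (x : X) :=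
  `|x| = 1 /\ forall y, `|y| <= c -> `|x + y| + `|x - y| = 2.

(* An isometric invariant. In [hyperplane r], a flat point of the unit sphere
   peaks at a single coordinate. Only a peak at the coordinate 0 gives an index
   [c < 1 / 2], since the coordinates then tend to [r] in absolute value, and
   this index is [(1 - r) / 2]. *)
Definition flat_index (X : normedModType R) (c : R) :=
  exists x : X, flat c x /\
    forall c' x', `|x + x'| = 2 -> flat c' x' -> c' <= c.

Lemma flat_isometry (X Y : normedModType R) (T : {linear X -> Y}) (c : R) x :
  (forall x, `|T x| = `|x|) -> (forall y, exists x, T x = y) ->
  flat c (T x) <-> flat c x.
Proof.
move=> Tn Ts; split=> -[x1 xc].
  split=> [|y yc]; first by rewrite -Tn.
  by have := xc (T y); rewrite -linearD -linearB !Tn; apply.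
split=> [|y]; first by rewrite Tn.
by have [z <-] := Ts y; rewrite -linearD -linearB !Tn; exact: xc.
Qed.

Lemma flat_index_isometry (X Y : normedModType R) (c : R) :
  isometrically_isomorphic X Y -> flat_index X c -> flat_index Y c.
Proof.
move=> [T [[S TK SK] Tn]] [x [xc xmax]].
have Ts y : exists x, T x = y by exists (S y); exact: SK.
exists (T x); split; first exact/flat_isometry.
move=> c' y'; have [z <-] := Ts y'; rewrite -linearD Tn => xz.
by move=> /(flat_isometry _ _ Tn Ts); exact: xmax.
Qed.

Variable r : R.
Hypotheses (r_gt0 : 0 < r) (r_lt1 : r < 1).
Local Notation X := (hyperplane r).

Let r_le1 : `|r| <= 1. Proof. by rewrite gtr0_norm// ltW. Qed.

(** Unlike [Num.sg], it is 1 at 0, so that its modulus is always 1. *)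
Let sgn (t : R) : R := (-1) ^+ (t < 0)%R.

Let sgn_norm t : `|sgn t| = 1. Proof. by rewrite normr_sign. Qed.

Let sgnE t (c : R) : 0 <= c -> `|t + c * sgn t| = `|t| + c.
Proof.
move=> c0; rewrite {1}[t]realEsign ?num_real// -/(sgn t) mulrC -mulrDl.
by rewrite normrM sgn_norm mulr1 ger0_norm// addr_ge0.
Qed.

(* If |x_k| + |x_n| > 2 - 2 c, perturbing both coordinates by c, one outwards
   and the other inwards, contradicts flatness. *)
Lemma flat_peak (c : R) (x : X) : 0 < c -> flat c x ->
  exists k, `|x k| = 1 /\ forall n, n != k -> `|x n| <= 1 - 2 * c.
Proof.
move=> c0 [x1 xc].
have two k n : n != k -> `|x k| + `|x n| + 2 * c <= 2.
  move=> nk.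
  pose a i : R := if i == k then c * sgn (x k) else
                  if i == n then - (c * sgn (x n)) else 0.
  pose y := hyperplane_trunc r (maxn k n) a.
  have yk : y k = c * sgn (x k).
    by rewrite hyperplane_truncE leq_maxl /a eqxx.
  have yn : y n = - (c * sgn (x n)).
    by rewrite hyperplane_truncE leq_maxr /a (negbTE nk) eqxx.
  have yc : `|y| <= c.
    apply: hyperplane_trunc_norm_le => // i _; rewrite /a.
    have cs t : `|c * sgn t| = c by rewrite normrM sgn_norm mulr1 gtr0_norm.
    case: eqP => _; first by rewrite cs.
    by case: eqP => _; rewrite ?normrN ?cs// normr0 ltW.
  have := hyperplane_app_le (x + y) k.
  have := hyperplane_app_le (x - y) n.
  rewrite -[(x + y) k]/(x k + y k) -[(x - y) n]/(x n - y n) yk yn opprK.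
  have := xc _ yc; rewrite !(sgnE _ (ltW c0)); lra.
have [k xk] : exists k, 1 - c < `|x k|.
  apply: contrapT => h; have : `|x| <= 1 - c.
    apply: hyperplane_norm_le => n; rewrite leNgt; apply/negP => hn.
    by apply: h; exists n.
  by rewrite x1; lra.
(* By [two] the other coordinates are at most 1 - c, so the supremum 1 is attained at [k]. *)
have xk1 : `|x k| = 1.
  apply/eqP; rewrite eq_le -{1}x1 hyperplane_app_le/= leNgt; apply/negP => h.
  have : `|x| <= Num.max `|x k| (1 - c).
    apply: hyperplane_norm_le => n; rewrite le_max.
    have [->|nk] := eqVneq n k; first by rewrite lexx.
    by apply/orP; right; have := two k n nk; lra.
  by rewrite x1 le_max => /orP[]; lra.
exists k; split => // n nk; have := two k n nk; rewrite xk1; lra.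
Qed.

(** Coordinate [k] still dominates after a perturbation [y] of norm at most [c], and there the norm
    is affine in [y]. *)
Lemma peak_flat (c : R) (x : X) k : 0 <= c -> c <= 1 / 2 -> `|x k| = 1 ->
  (forall n, n != k -> `|x n| <= 1 - 2 * c) -> flat c x.
Proof.
move=> c0 c2 xk xn.
have nP y : `|y| <= c -> `|x + y| = 1 + sgn (x k) * y k.
  move=> yc.
  have yk : `|sgn (x k) * y k| <= c.
    by rewrite normrM sgn_norm mul1r (le_trans (hyperplane_app_le _ _)).
  have xyk : `|x k + y k| = 1 + sgn (x k) * y k.
    have -> : `|x k + y k| = `|sgn (x k) * (x k + y k)|.
      by rewrite normrM sgn_norm mul1r.
    rewrite mulrDr; have -> : sgn (x k) * x k = 1.
      by rewrite {2}[x k]realEsign ?num_real// xk mulr1 -expr2 sqrr_sign.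
    by rewrite ger0_norm//; move: yk; rewrite ler_norml; lra.
  apply/eqP; rewrite eq_le; apply/andP; split; last first.
    by rewrite -xyk; exact: (hyperplane_app_le (x + y)).
  apply: hyperplane_norm_le => n; rewrite -[(x + y) n]/(x n + y n).
  have [->|nk] := eqVneq n k; first by rewrite xyk.
  rewrite (le_trans (ler_normD _ _))//.
  have := xn n nk; have := le_trans (hyperplane_app_le y n) yc.
  by move: yk; rewrite ler_norml; lra.
split.
  by have := nP 0; rewrite normr0 addr0 mulr0 addr0; exact.
move=> y yc; rewrite nP// nP ?normrN//.
rewrite -[(- y) k]/(- y k); ring.
Qed.

(** The value of [c] solves 1 - 2 c = r, the modulus of the other coordinates. *)
Let head_peak (s : R) : `|s| = 1 ->
  flat ((1 - r) / 2) (hyperplane_trunc r 0 (fun=> s)).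
Proof.
have [r0 r1] := (r_gt0, r_lt1).
move=> s1; apply: (@peak_flat _ _ 0%N) => //; [lra|lra|].
move=> n n0; rewrite hyperplane_truncE leqn0 (negbTE n0).
rewrite normrM s1 gtr0_norm//; lra.
Qed.

(** The coordinates tend to [r] in absolute value, whence r <= 1 - 2 c. *)
Let head_peak_bound (c : R) (x : X) :
  `|x 0%N| = 1 -> (forall n, n != 0%N -> `|x n| <= 1 - 2 * c) ->
  c <= (1 - r) / 2.
Proof.
have [r0 r1] := (r_gt0, r_lt1).
move=> x0 xn.
have h : `|x n| @[n --> \oo] --> `|r * x 0%N|.
  by apply: cvg_norm; exact: hyperplane_cvg.
have : `|r * x 0%N| <= 1 - 2 * c.
  apply: (cvgr_to_le h); near=> n; apply: xn.
  by rewrite -lt0n; near: n; exact: nbhs_infty_gt.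
rewrite normrM x0 gtr0_norm//; lra.
Unshelve. all: by end_near. Qed.

Lemma hyperplane_flat_index : flat_index X ((1 - r) / 2).
Proof.
have [r0 r1] := (r_gt0, r_lt1).
exists (hyperplane_trunc r 0 (fun=> 1)); split.
  by apply: head_peak; rewrite normr1.
move=> c x ux xc; have [c0|c0] := ltP 0 c; last by lra.
have [k [xk xn]] := flat_peak c0 xc.
have [k0|k0] := eqVneq k 0%N; first by subst k; exact: head_peak_bound xn.
(* If [x] peaks away from 0, its head is at most 1 - 2 c and the other coordinates of the witness
   are [r], so the sum has norm below 2. *)
have : `|hyperplane_trunc r 0 (fun=> 1) + x| <= Num.max (1 + r) (2 - 2 * c).
  apply: hyperplane_norm_le => n.
  rewrite (_ : (_ + x) n = hyperplane_trunc r 0 (fun=> 1) n + x n)//.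
  rewrite hyperplane_truncE leqn0 le_max; case: eqVneq => [->|n0].
    apply/orP; right; rewrite (le_trans (ler_normD _ _))// normr1.
    by have := xn 0%N; rewrite eq_sym k0 => /(_ isT); lra.
  apply/orP; left; rewrite mulr1 (le_trans (ler_normD _ _))// gtr0_norm//.
  by rewrite addrC lerD2r; have [x1 _] := xc; rewrite -x1 hyperplane_app_le.
by rewrite ux le_max => /orP[]; lra.
Qed.

Lemma hyperplane_flat_index_unique (c : R) :
  0 < c < 1 / 2 -> flat_index X c -> c = (1 - r) / 2.
Proof.
have [r0 r1] := (r_gt0, r_lt1).
move=> /andP[c0 c2] [x [xc xmax]].
have [[|k] [xk xn]] := flat_peak c0 xc.
  apply/eqP; rewrite eq_le (head_peak_bound xk xn)/=.
  (* The competitor x_0 (1, r, r, ...) shares the peak of [x], so the sum has norm 2. *)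
  apply: (xmax _ _ _ (head_peak xk)).
  apply/eqP; rewrite eq_le; apply/andP; split.
    have [h1 _] := xc; have [h2 _] := head_peak xk.
    by rewrite (le_trans (ler_normD _ _))// h1 h2.
  rewrite (le_trans _ (hyperplane_app_le _ 0%N))//.
  rewrite -[X in `|X|]/(x 0%N + x 0%N).
  have -> : x 0%N + x 0%N = 2 * x 0%N by ring.
  by rewrite normrM xk mulr1 normr_nat.
(* For a peak elsewhere, a signed unit vector with the same peak is flat up to 1 / 2, against
   [c < 1 / 2]. *)
have ef : flat (1 / 2) (x k.+1 *: hyperplane_delta r k).
  apply: (@peak_flat _ _ k.+1) => //.
    rewrite -[X in `|X|]/(x k.+1 * (k.+1 == k.+1)%:R).
    by rewrite eqxx mulr1.
  move=> n nk; rewrite -[X in `|X|]/(x k.+1 * (n == k.+1)%:R).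
  by rewrite (negbTE nk) mulr0 normr0; lra.
have : 1 / 2 <= c.
  apply: (xmax _ _ _ ef); apply/eqP; rewrite eq_le; apply/andP; split.
    have [h1 _] := xc; have [h2 _] := ef.
    by rewrite (le_trans (ler_normD _ _))// h1 h2.
  rewrite (le_trans _ (hyperplane_app_le _ k.+1))//.
  rewrite -[X in `|X|]/(x k.+1 + x k.+1 * (k.+1 == k.+1)%:R).
  rewrite eqxx mulr1; have -> : x k.+1 + x k.+1 = 2 * x k.+1 by ring.
  by rewrite normrM xk mulr1 normr_nat.
by lra.
Qed.

End HyperplaneIndex.

(** * Uncountably many isometry classes *)

Lemma hyperplane_not_isometric (R : realType) (r s : R) :
  0 < r < 1 -> 0 < s < 1 ->
  isometrically_isomorphic (hyperplane r) (hyperplane s) -> r = s.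
Proof.
move=> /andP[r0 r1] /andP[s0 s1] /flat_index_isometry rs.
have := rs _ (hyperplane_flat_index r0 r1).
move=> /(hyperplane_flat_index_unique s0 s1); lra.
Qed.

(** Countable sets are Lebesgue null, whereas the interval has measure 1. *)
Lemma open_unit_interval_uncountable (R : realType) :
  ~ countable [set: {r : R | 0 < r < 1}].
Proof.
move=> cI; have : countable (`]0, 1[%classic : set R).
  apply: (@sub_countable _ _ _ (@sval R _ @` [set: {r : R | 0 < r < 1}])).
    apply: subset_card_le => x /=; rewrite in_itv/= => x01.
    by exists (exist _ x x01).
  by apply: sub_countable cI; exact: card_image_le.
move=> /countable_lebesgue_measure0.
rewrite lebesgue_measure_itv/= lte_fin ltr01 oppr0 adde0 => /eqP.
by rewrite onee_eq0.
Qed.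

Theorem mainTheorem9 (R : realType) :
  exists (I : Type) (X : I -> completeNormedModType R),
    [/\ ~ countable [set: I],
        (forall i j : I, i <> j -> ~ isometrically_isomorphic (X i) (X j)) &
        (forall i : I,
           [/\ isometrically_isomorphic (dual (X i)) (ell1 R),
               Hahn_Banach_smooth (X i) &
               ~ M_embedded (X i)])].
Proof.
exists {r : R | 0 < r < 1}, (fun i => hyperplane (sval i)); split.
- exact: open_unit_interval_uncountable.
- move=> [r r01] [s s01] rs /(hyperplane_not_isometric r01 s01)/= rsE.
  by apply: rs; exact: val_inj.
- move=> [r /= /andP[r0 r1]].
  have rn : `|r| <= 1 by rewrite gtr0_norm// ltW.
  have [S TK SK] := isometry_linear_inverse (hyperplane_pairing_norm rn)
    (hyperplane_pairing_surj rn).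
  (* The unit vectors act as the coordinates, so this weak* convergence is the limit condition
     defining the space. *)
  have dcvg (x : hyperplane r) :
      hyperplane_pairing r (ell1_delta n) x @[n --> \oo] -->
      r * hyperplane_pairing r (ell1_delta 0) x.
    rewrite hyperplane_pairing_delta.
    under eq_fun do rewrite hyperplane_pairing_delta.
    exact: hyperplane_cvg.
  split.
  + exact: hyperplane_dual_ell1.
  + exact: (ell1_predual_Hahn_Banach_smooth TK SK
      (hyperplane_pairing_norm rn) r0 r1 dcvg).
  + exact: (ell1_predual_not_M_embedded TK SK
      (hyperplane_pairing_norm rn) r0 dcvg).
Qed.
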